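(* Let $n\in\mathbb{N}$, $p\in(0,1)$, let $G\in\mathcal{G}(n,p)$, and let $\ell_1,\dots,\ell_n$ be the eigenvalues of its Laplacian, with $\ell_1=0$ the zero eigenvalue. Then for all $i\in\{2,\dots,n\}$, \begin{align*} \mathbb{E}[\ell_i] &= np,\\ \mathbb{E}[\ell_i^2] &= n(n-2)p^2+2np,\\ \mathbb{E}[\ell_i^3] &= n(n-2)(n-4)p^3+6n(n-2)p^2+4np,\\ \mathbb{E}[\ell_i^4] &= n(n-7)(n-3)(n-2)p^4+6n(2n-7)(n-2)p^3+25n(n-2)p^2+8np. \end{align*}
   Context: $\mathcal{G}(n,p)$ denotes the Erdős–Rényi model: a simple undirected graph on nodes $[n]$ in which each of the $\binom{n}{2}$ possible edges is present independently with probability $p$. The Laplacian is $L=D-A$, with $A$ the adjacency matrix and $D=\mathrm{diag}(d_1,\dots,d_n)$, $d_i$ the degree of node $i$. The eigenvalues of $L$ are treated as an unordered collection of random variables $\ell_1,\dots,\ell_n$, with the convention that $\ell_1=0$ is the zero eigenvalue that every Laplacian has. *)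

(* Defs.v *)
From HB Require Import structures.
From mathcomp Require Import all_boot all_order all_algebra all_fingroup.
From mathcomp Require Import complex.
Set Implicit Arguments. Unset Strict Implicit. Unset Printing Implicit Defensive.
Import Order.TTheory GRing.Theory Num.Theory.
Local Open Scope ring_scope.
Local Open Scope complex_scope.

(* A simple undirected graph on the nodes 'I_n is given by its edge set,
   a set of pairs (i,j) with i < j (each unordered edge {i,j} appears once). *)
Definition upper_pairs (n : nat) : {set 'I_n * 'I_n} :=
  [set e : 'I_n * 'I_n | (e.1 < e.2)%N].

Definition is_graph (n : nat) (E : {set 'I_n * 'I_n}) : bool :=
  E \subset upper_pairs n.

Definition adj (n : nat) (E : {set 'I_n * 'I_n}) (i j : 'I_n) : bool :=
  ((i, j) \in E) || ((j, i) \in E).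

Definition degree (n : nat) (E : {set 'I_n * 'I_n}) (i : 'I_n) : nat :=
  #|[set j | adj E i j]|.

Definition laplacian (R : ringType) (n : nat) (E : {set 'I_n * 'I_n})
  : 'M[R]_n :=
  \matrix_(i, j) ((degree E i)%:R *+ (i == j) - (adj E i j)%:R).

Definition gnp_weight (R : ringType) (n : nat) (p : R)
  (E : {set 'I_n * 'I_n}) : R :=
  p ^+ #|E| * (1 - p) ^+ ('C(n, 2) - #|E|).

(* The eigenvalues of L (with multiplicity), computed in R[i], which is
   algebraically closed: the roots of the characteristic polynomial. *)
Definition lap_eigs (R : rcfType) (n : nat) (E : {set 'I_n * 'I_n})
  : seq R[i] :=
  sval (closed_field_poly_normal
          (char_poly (map_mx (fun x : R => x%:C) (laplacian R E)))).

(* The non-distinguished eigenvalues: remove one copy of the zero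
   eigenvalue ell_1 = 0. *)
Definition lap_eigs_nz (R : rcfType) (n : nat) (E : {set 'I_n * 'I_n})
  : seq R[i] := rem 0 (lap_eigs R E).

(* The eigenvalues as an unordered collection: ell_2, ..., ell_n are the
   elements of lap_eigs_nz listed in a uniformly random order, given by a
   uniformly random permutation sigma of 'I_(n-1).  ell_i (2 <= i <= n) is
   the entry of lap_eigs_nz at position sigma (i-2). *)
Definition ell (R : rcfType) (n : nat) (E : {set 'I_n * 'I_n})
  (sigma : 'S_(n.-1)) (i : nat) : R[i] :=
  nth 0 (lap_eigs_nz R E)
    (oapp (fun j : 'I_(n.-1) => val (sigma j)) (i - 2)%N (insub (i - 2)%N)).

Definition expect (R : rcfType) (n : nat) (p : R)
  (f : {set 'I_n * 'I_n} -> 'S_(n.-1) -> R[i]) : R[i] :=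
  \sum_(E : {set 'I_n * 'I_n} | is_graph E)
    \sum_(sigma : 'S_(n.-1))
      ((gnp_weight p E / ((n.-1)`!)%:R)%:C * f E sigma).
Arguments expect {R} n p f.

(* Main.v *)
Require Import Defs.
From HB Require Import structures.
From mathcomp Require Import all_boot all_order all_algebra all_fingroup.
From mathcomp Require Import complex zify ring.
Import Order.TTheory GRing.Theory Num.Theory.
Local Open Scope ring_scope.
Local Open Scope complex_scope.

(** A uniformly ordered nonzero eigenvalue has k-th moment E[tr L^k] / (n - 1).
    Since (L v)_i is the sum over j of x_ij (v_i - v_j), with x_ij the edge
    indicators, expanding tr L^k gives a signed sum over k + 1 vertices of
    products of edge indicators, whose expectation is p to the number of
    distinct edges. Such an expectation depends only on which of the vertices
    coincide, so E[tr L^k] is a combination of the n(n-1)...(n-m+1) p^e with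
    m <= k + 1 and e <= k, whose coefficients do not depend on n and are
    computed by enumerating the coincidence patterns. *)

(** * Traces of powers as power sums of eigenvalues *)

Lemma mulmx_unit_exp (R : comUnitRingType) (n : nat) (P D : 'M[R]_n) (k : nat) :
  P \in unitmx -> (invmx P *m D *m P) ^+ k = invmx P *m D ^+ k *m P.
Proof.
move=> uP; elim: k => [|k IHk]; first by rewrite !expr0 mulmx1 mulVmx.
by rewrite !exprS IHk -[LHS]/(_ *m _) -[_ * _]/(_ *m _) !mulmxA mulmxK.
Qed.

Lemma diag_mx_exp (R : comPzRingType) (n : nat) (d : 'rV[R]_n) (k : nat) :
  diag_mx d ^+ k = diag_mx (\row_j d 0 j ^+ k).
Proof.
elim: k => [|k IHk].
  by rewrite expr0 -[LHS]diag_const_mx; congr diag_mx; apply/rowP => j; rewrite !mxE.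
rewrite exprS IHk -[LHS]/(_ *m _) mulmx_diag; congr diag_mx.
by apply/rowP => j; rewrite !mxE exprS.
Qed.

Lemma char_poly_conj (R : comUnitRingType) (n : nat) (P D : 'M[R]_n) :
  P \in unitmx -> char_poly (invmx P *m D *m P) = char_poly D.
Proof.
move=> uP; rewrite /char_poly /char_poly_mx !map_mxM.
have PK : map_mx polyC (invmx P) *m map_mx polyC P = 1%:M.
  by rewrite -map_mxM mulVmx // map_mx1.
have -> : 'X%:M - map_mx polyC (invmx P) *m map_mx polyC D *m map_mx polyC P
    = map_mx polyC (invmx P) *m ('X%:M - map_mx polyC D) *m map_mx polyC P.
  by rewrite mulmxBr mulmxBl mul_mx_scalar -scalemxAl PK scalemx1.
by rewrite !det_mulmx mulrAC -det_mulmx PK det1 mul1r.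
Qed.

(** The spectral theorem diagonalizes [A]; conjugation preserves the trace and the characteristic
    polynomial, and unique factorization makes [s] a permutation of the diagonal. *)
Lemma mxtrace_exp_char_poly (C : numClosedFieldType) (n : nat) (A : 'M[C]_n)
    (s : seq C) (k : nat) :
  A \is normalmx -> char_poly A = \prod_(x <- s) ('X - x%:P) ->
  \tr (A ^+ k) = \sum_(x <- s) x ^+ k.
Proof.
move=> /orthomx_spectralP; set P := spectralmx A; set d := spectral_diag A => AE.
have uP : P \in unitmx by apply: spectral_unit.
rewrite AE char_poly_conj // char_poly_trig; last first.
  exact/is_diag_mx_is_trig/diag_mx_is_diag.
rewrite (eq_bigr (fun i => 'X - (d 0 i)%:P)); last first.
  by move=> i _; rewrite !mxE eqxx.
rewrite -(big_map (d 0) xpredT (fun x => 'X - x%:P)) => /prod_XsubC_eq sE.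
rewrite -(perm_big _ sE) big_map mulmx_unit_exp // mxtrace_mulC mulmxA mulmxV //.
by rewrite mul1mx diag_mx_exp mxtrace_diag; apply: eq_bigr => i _; rewrite mxE.
Qed.

(** Composing with a transposition shows that the sum over [s] does not depend on [j], so it can be
    averaged over all positions. *)
Lemma sum_perm_apply (R : pzSemiRingType) (n : nat) (g : 'I_n -> R) (j : 'I_n) :
  n%:R * (\sum_(s : 'S_n) g (s j)) = n`!%:R * \sum_i g i.
Proof.
have E i : \sum_(s : 'S_n) g (s i) = \sum_(s : 'S_n) g (s j).
  rewrite (reindex_inj (mulgI (tperm i j))) /=; apply: eq_bigr => s _.
  by rewrite permM tpermL.
rewrite mulr_natl -[n in _ *+ n]card_ord -sumr_const.
rewrite (eq_bigr (fun i => \sum_(s : 'S_n) g (s i))) => [|i _]; last by rewrite E.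
rewrite exchange_big /= (eq_bigr (fun=> \sum_i g i)) => [|s _]; last first.
  by rewrite [RHS](reindex_inj (@perm_inj _ s)).
by rewrite sumr_const mulr_natl card_Sn.
Qed.

(** * Edge probabilities in the random graph *)

Lemma upper_pairs_card (n : nat) : #|upper_pairs n| = 'C(n, 2).
Proof.
rewrite -bin2_sum -sum1_card /upper_pairs.
rewrite (eq_bigl (fun e : 'I_n * 'I_n => (e.1 < e.2)%N)); last by move=> e; rewrite inE.
rewrite -(pair_big_dep xpredT (fun i j : 'I_n => (i < j)%N) (fun _ _ => 1%N)) /=.
rewrite (exchange_big_dep xpredT) //= big_mkord; apply: eq_bigr => j _.
by rewrite -(big_ord_widen n (fun=> 1%N) (ltnW (ltn_ord j))) sum_nat_const card_ord muln1.
Qed.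

(** A product over all pairs of the sums [F e + G e] expands into a sum over edge sets: [F e] weighs
    the presence of [e], [G e] its absence, and [F e + G e] is [p] on [S] and 1 elsewhere. *)
Lemma gnp_prob_subset (R : comNzRingType) (n : nat) (p : R) (S : {set 'I_n * 'I_n}) :
  S \subset upper_pairs n ->
  \sum_(E | is_graph E && (S \subset E)) gnp_weight p E = p ^+ #|S|.
Proof.
move=> SU; set U := upper_pairs n.
pose F e := if e \in U then p else 0.
pose G e := if e \in S then 0 else if e \in U then 1 - p else 1.
have -> : p ^+ #|S| = \prod_e (F e + G e).
  rewrite -prodr_const big_mkcond; apply: eq_bigr => e _; rewrite /F /G.
  case: ifP => [/(subsetP SU) -> | _]; first by rewrite addr0.
  by case: ifP; rewrite ?add0r // addrC subrK.
rewrite bigA_distr big_mkcond; apply: eq_bigr => /= E _.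
have [/andP[EU SE]|] := boolP (is_graph E && (S \subset E)).
  rewrite (bigID [in E]) /= (eq_bigr (fun=> p)) => [|e eE]; last first.
    by rewrite eE /F (subsetP EU).
  rewrite prodr_const [X in _ * X](eq_bigr (fun e => if e \in U then 1 - p else 1)).
    rewrite -big_mkcondr prodr_const /gnp_weight -upper_pairs_card.
    rewrite -(cardsID E (upper_pairs n)) (setIidPr EU) addKn.
    by congr (_ * _ ^+ _); apply: eq_card => e; rewrite in_setD.
  move=> e eE; rewrite (negbTE eE) /G ifN //.
  by apply: contra eE => /(subsetP SE).
(* Otherwise a factor vanishes: [F] at an element of [E] outside [U], or [G] at an element of [S]
   missing from [E]. *)
rewrite negb_and => /orP[/subsetPn[e eE eU]|/subsetPn[e eS eE]].
  by rewrite (bigD1 e) //= eE /F (negbTE eU) mul0r.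
by rewrite (bigD1 e) //= (negbTE eE) /G eS mul0r.
Qed.

Definition loopless {T : eqType} (l : seq (T * T)) : bool :=
  all (fun e => e.1 != e.2) l.

(** An undirected edge is counted at its last occurrence in either orientation. Any [eqType] is
    allowed, so that numeric labels can be used for computation. *)
Fixpoint edge_count {T : eqType} (l : seq (T * T)) : nat :=
  if l is e :: l' then ((e \notin l') && ((e.2, e.1) \notin l') + edge_count l')%N
  else 0%N.

Definition orient {n : nat} (e : 'I_n * 'I_n) : 'I_n * 'I_n :=
  if (e.1 < e.2)%N then e else (e.2, e.1).

Lemma orient_upper (n : nat) (e : 'I_n * 'I_n) :
  e.1 != e.2 -> orient e \in upper_pairs n.
Proof.
by case: e => i j /=; rewrite /orient inE -val_eqE /=; case: (ltngtP i j).
Qed.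

Lemma orient_eq (n : nat) (e f : 'I_n * 'I_n) :
  (orient e == orient f) = (e == f) || ((e.2, e.1) == f).
Proof.
case: e f => [i j] [k l]; rewrite /orient /= ; do 2 case: ifP.
all: rewrite !xpair_eqE -!val_eqE /=; lia.
Qed.

Lemma adj_orient (n : nat) (E : {set 'I_n * 'I_n}) (e : 'I_n * 'I_n) :
  is_graph E -> adj E e.1 e.2 = (e.1 != e.2) && (orient e \in E).
Proof.
case: e => i j EU; rewrite /adj /orient /=.
have Nin (a b : 'I_n) : (b <= a)%N -> ((a, b) \in E) = false.
  move=> ba; apply/negP => /(subsetP EU); rewrite inE /=; lia.
rewrite -val_eqE; case: ltngtP => /= ij.
- by rewrite [(j, i) \in E]Nin ?orbF // ltnW.
- by rewrite [(i, j) \in E]Nin // ltnW.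
- by rewrite !Nin ?ij.
Qed.

Lemma card_orient (n : nat) (l : seq ('I_n * 'I_n)) :
  #|[set e in map orient l]| = edge_count l.
Proof.
elim: l => [|e l IHl] /=; first by apply/eqP; rewrite cards_eq0; apply/eqP/setP => e; rewrite !inE.
rewrite set_cons cardsU1 IHl inE -negb_or; congr (~~ _ + _)%N.
apply/mapP/orP => [[f fl /eqP]|].
  by rewrite orient_eq => /orP[/eqP->|/eqP->]; [left|right].
by case=> h; [exists e|exists (e.2, e.1)] => //; apply/eqP; rewrite orient_eq eqxx ?orbT.
Qed.

(** Without loops the product is the indicator that all the oriented pairs lie in [E], and repeated
    edges collapse in that set; a loop makes the product zero. *)
Lemma gnp_expect_adj_prod (R : comNzRingType) (n : nat) (p : R) (l : seq ('I_n * 'I_n)) :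
  \sum_(E | is_graph E) gnp_weight p E * \prod_(e <- l) (adj E e.1 e.2)%:R
  = if loopless l then p ^+ edge_count l else 0.
Proof.
have adjE E : is_graph E -> \prod_(e <- l) (adj E e.1 e.2)%:R
    = (loopless l && ([set e in map orient l] \subset E))%:R :> R.
  move=> gE; elim: l => [|e l IHl].
    by rewrite big_nil [_ \subset E](_ : _ = true) //; apply/subsetP => e; rewrite inE.
  rewrite big_cons IHl adj_orient //= set_cons subUset sub1set -natrM mulnb.
  by rewrite andbACA.
rewrite (eq_bigr _ (fun E gE => congr1 _ (adjE E gE))).
case: ifP => [ll|_]; last by rewrite big1 // => E _; rewrite mulr0.
rewrite -card_orient -gnp_prob_subset; last first.
  apply/subsetP => f; rewrite inE => /mapP[e el ->].
  exact/orient_upper/(allP ll).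
rewrite big_mkcondr; apply: eq_bigr => E _.
by case: ifP; rewrite /= ?mulr1 ?mulr0.
Qed.

(** * Expansion of powers of the Laplacian along walks *)

Lemma laplacian_expS (R : nzRingType) (n : nat) (E : {set 'I_n * 'I_n})
    (k : nat) (i b : 'I_n) :
  (laplacian R E ^+ k.+1) i b
  = \sum_j (adj E i j)%:R * ((laplacian R E ^+ k) i b - (laplacian R E ^+ k) j b).
Proof.
rewrite exprS -[_ * _]/(_ *m _) mxE; set B := _ ^+ k.
under [RHS]eq_bigr do rewrite mulrBr.
under [LHS]eq_bigr do rewrite mxE mulrBl.
rewrite !sumrB; congr (_ - _); rewrite -mulr_suml (bigD1 i) //= eqxx mulr1n.
rewrite big1 ?addr0 => [|j /negbTE ji]; last by rewrite eq_sym ji mul0r.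
(* The degree, as a sum of edge indicators, supplies the terms with [(L^k) i b]. *)
congr (_ * _); rewrite /degree -sum1_card natr_sum big_mkcond.
by apply: eq_bigr => j _; rewrite inE; case: (adj E i j).
Qed.

(* The expectation of x_l (L^k)_(i,b), with x_l the product of the edge
   indicators listed in [l]. *)
Definition walk_moment {R : comNzRingType} {n : nat} (p : R) (k : nat) (i b : 'I_n)
    (l : seq ('I_n * 'I_n)) : R :=
  \sum_(E | is_graph E) gnp_weight p E *
    (\prod_(e <- l) (adj E e.1 e.2)%:R * (laplacian R E ^+ k) i b).

Lemma walk_moment0 (R : comNzRingType) (n : nat) (p : R) (i b : 'I_n) l :
  walk_moment p 0 i b l = if (i == b) && loopless l then p ^+ edge_count l else 0.
Proof.
rewrite /walk_moment; case: (altP (i =P b)) => [<-|/negbTE ib] /=.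
  rewrite -gnp_expect_adj_prod; apply: eq_bigr => E _.
  by rewrite expr0 mxE eqxx mulr1.
by rewrite big1 // => E _; rewrite expr0 mxE ib !mulr0.
Qed.

Lemma walk_momentS (R : comNzRingType) (n : nat) (p : R) (k : nat) (i b : 'I_n) l :
  walk_moment p k.+1 i b l
  = \sum_j (walk_moment p k i b ((i, j) :: l) - walk_moment p k j b ((i, j) :: l)).
Proof.
rewrite /walk_moment; under [RHS]eq_bigr do rewrite -sumrB.
rewrite exchange_big /=; apply: eq_bigr => E _.
rewrite laplacian_expS !mulr_sumr; apply: eq_bigr => j _.
rewrite !big_cons /=; ring.
Qed.

(* [walk_moment] at vertices numbered [0 .. m-1] in order of first appearance:
   by exchangeability the new vertex [j] of [walk_momentS] is either one of
   those or one of [N - m] interchangeable fresh ones, numbered [m]. *)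
Fixpoint walk_value {R : pzRingType} (N p : R) (k i b : nat) (l : seq (nat * nat))
    (m : nat) : R :=
  if k is k'.+1 then
    \sum_(j < m) (walk_value N p k' i b ((i, j : nat) :: l) m
                  - walk_value N p k' j b ((i, j : nat) :: l) m)
    + (N - m%:R) * (walk_value N p k' i b ((i, m) :: l) m.+1
                    - walk_value N p k' m b ((i, m) :: l) m.+1)
  else if (i == b) && loopless l then p ^+ edge_count l else 0.

(** * Exchangeability of the vertices *)

Definition map_pairs {T U : Type} (f : T -> U) (l : seq (T * T)) : seq (U * U) :=
  [seq (f e.1, f e.2) | e <- l].

Definition pairs_in {T : Type} (D : pred T) (l : seq (T * T)) : bool :=
  all (fun e => D e.1 && D e.2) l.

Lemma loopless_map {T U : eqType} {D : pred T} {f : T -> U} {l : seq (T * T)} :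
  {in D &, injective f} -> pairs_in D l -> loopless (map_pairs f l) = loopless l.
Proof.
move=> fI /allP Dl; rewrite /loopless all_map; apply: eq_in_all => e /Dl /andP[D1 D2].
by rewrite /= (inj_in_eq fI).
Qed.

Lemma edge_count_map {T U : eqType} {D : pred T} {f : T -> U} {l : seq (T * T)} :
  {in D &, injective f} -> pairs_in D l -> edge_count (map_pairs f l) = edge_count l.
Proof.
move=> fI; elim: l => //= e l IHl /andP[/andP[D1 D2] Dl]; rewrite IHl //.
have memE a b : D a -> D b -> ((f a, f b) \in map_pairs f l) = ((a, b) \in l).
  move=> Da Db; apply/mapP/idP => [[[c d] cdl /= [/fI + /fI]]|abl]; last by exists (a, b).
  by have /andP[Dc Dd] := allP Dl _ cdl; move=> -> // -> //.
by rewrite !memE //; case: e D1 D2.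
Qed.

(** Here [s] lists the vertices met so far, and a label is a position in [s]. The next vertex is
    either in [s] already or is appended to it, with label [size s]. *)
Lemma walk_moment_value (R : comNzRingType) (n : nat) (p : R) (x0 : 'I_n) (k : nat)
    (s : seq 'I_n) (i b : nat) (l : seq (nat * nat)) :
  uniq s -> (i < size s)%N -> (b < size s)%N -> pairs_in (fun a => a < size s)%N l ->
  walk_moment p k (nth x0 s i) (nth x0 s b) (map_pairs (nth x0 s) l)
  = walk_value n%:R p k i b l (size s).
Proof.
elim: k s i b l => [|k IHk] s i b l us si sb sl /=.
  have sI : {in (fun a => a < size s)%N &, injective (nth x0 s)}.
    by move=> a c sa sc /eqP; rewrite nth_uniq // => /eqP.
  by rewrite walk_moment0 nth_uniq // (loopless_map sI sl) (edge_count_map sI sl).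
rewrite walk_momentS (bigID [in s]) /=; congr (_ + _).
  rewrite -big_uniq // (big_nth x0) big_mkord; apply: eq_bigr => j _.
  have sjl : pairs_in (fun a => a < size s)%N ((i, j : nat) :: l).
    by rewrite /pairs_in /= si ltn_ord.
  have := IHk s i b _ us si sb sjl; have := IHk s j b _ us (ltn_ord j) sb sjl.
  by move=> /= -> ->.
(* [V] is the contribution of any vertex outside [s], whichever it is. *)
set V := walk_value _ _ _ _ _ _ _ - _.
transitivity (\sum_(j | j \notin s) V).
  apply: eq_bigr => j js.
  have sj : size (rcons s j) = (size s).+1 by rewrite size_rcons.
  have nthE a : (a < size s)%N -> nth x0 s a = nth x0 (rcons s j) a.
    by move=> sa; rewrite nth_rcons sa.
  have nthj : j = nth x0 (rcons s j) (size s) by rewrite nth_rcons ltnn eqxx.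
  have mapE : map_pairs (nth x0 s) l = map_pairs (nth x0 (rcons s j)) l.
    by apply/eq_in_map => e /(allP sl) /andP[s1 s2]; rewrite !nthE.
  have slS : pairs_in (fun a => a < (size s).+1)%N ((i, size s) :: l).
    rewrite /= ltnS (ltnW si) ltnSn /=; apply/allP => e /(allP sl) /andP[s1 s2].
    by rewrite !ltnS (ltnW s1) (ltnW s2).
  have us' : uniq (rcons s j) by rewrite rcons_uniq js.
  rewrite -sj in slS.
  have lt_rcons a : (a < size s)%N -> (a < size (rcons s j))%N.
    by rewrite sj ltnS => /ltnW.
  have s_lt : (size s < size (rcons s j))%N by rewrite sj.
  have := IHk _ i b _ us' (lt_rcons _ si) (lt_rcons _ sb) slS.
  have := IHk _ _ b _ us' s_lt (lt_rcons _ sb) slS.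
  by rewrite /= -mapE -(nthE i) // -(nthE b) // -nthj sj => -> ->.
rewrite -[LHS]/(\sum_(j in [predC s]) V) sumr_const -[V *+ _]mulr_natl; congr (_ * _).
have /(congr1 (fun m => m%:R : R)) <- : (size s + #|[predC s]| = n)%N.
  by rewrite -(card_uniqP us) cardC card_ord.
by rewrite natrD addrC addKr.
Qed.

(** * Symbolic expansion into falling factorials *)

(* A term [(s, m, e)] stands for (-1)^s N(N-1)...(N-m+1) p^e. *)
Fixpoint walk_terms (k i b : nat) (l : seq (nat * nat)) (m : nat)
    : seq (bool * nat * nat) :=
  if k is k'.+1 then
    let steps j m' := walk_terms k' i b ((i, j) :: l) m'
      ++ [seq (~~ t.1.1, t.1.2, t.2) | t <- walk_terms k' j b ((i, j) :: l) m'] in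
    flatten [seq steps j m | j <- iota 0 m] ++ steps m m.+1
  else if (i == b) && loopless l then [:: (false, m, edge_count l)] else [::].

Definition falling {R : pzRingType} (N : R) (m : nat) : R := \prod_(t < m) (N - t%:R).

Definition term_value {R : pzRingType} (N p : R) (t : bool * nat * nat) : R :=
  (-1) ^+ t.1.1 * falling N t.1.2 * p ^+ t.2.

(** A fresh vertex brings the factor [N - m], which turns [falling N m] into [falling N m.+1], the
    weight needed for [m.+1] labels. *)
Lemma walk_value_terms (R : comPzRingType) (N p : R) (k i b : nat) l m :
  falling N m * walk_value N p k i b l m
  = \sum_(t <- walk_terms k i b l m) term_value N p t.
Proof.
elim: k i b l m => [|k IHk] i b l m /=.
  case: ifP => _; last by rewrite big_nil mulr0.
  by rewrite big_seq1 /term_value expr0 mul1r.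
have stepE j m' :
    falling N m' * (walk_value N p k i b ((i, j) :: l) m'
                    - walk_value N p k j b ((i, j) :: l) m')
    = \sum_(t <- walk_terms k i b ((i, j) :: l) m'
        ++ [seq (~~ t.1.1, t.1.2, t.2) | t <- walk_terms k j b ((i, j) :: l) m'])
      term_value N p t.
  rewrite big_cat big_map mulrBr !IHk -sumrN; congr (_ + _); apply: eq_bigr => t _.
  by rewrite /term_value /= signrN !mulNr.
rewrite big_cat big_flatten big_map mulrDr mulrA mulr_sumr; congr (_ + _).
  rewrite -[m in iota 0 m]subn0 big_mkord.
  by apply: eq_bigr => j _; rewrite stepE.
by rewrite -stepE /falling big_ord_recr.
Qed.

(** All diagonal entries have the same expectation, computed from a single vertex labelled 0; the
    [n] choices of that vertex give [falling N 1]. *)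
Lemma expect_tr_laplacian (R : comNzRingType) (n : nat) (p : R) (k : nat) :
  \sum_(E : {set 'I_n * 'I_n} | is_graph E) gnp_weight p E * \tr (laplacian R E ^+ k)
  = \sum_(t <- walk_terms k 0 0 [::] 1) term_value n%:R p t.
Proof.
transitivity (\sum_(i : 'I_n) walk_value n%:R p k 0 0 [::] 1).
  under eq_bigr do rewrite /mxtrace mulr_sumr.
  rewrite exchange_big /=; apply: eq_bigr => i _.
  have := walk_moment_value R n p i k [:: i] 0 0 [::] isT isT isT isT; move=> /= <-.
  by apply: eq_bigr => E _; rewrite big_nil mul1r.
by rewrite sumr_const card_ord -[LHS]mulr_natl -walk_value_terms /falling big_ord1 /= subr0.
Qed.

(** Merging equal terms leaves a short sum for the final computation. *)
Lemma sum_term_value_tally (R : comPzRingType) (N p : R) (s : seq (bool * nat * nat)) :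
  \sum_(t <- s) term_value N p t
  = \sum_(tc <- tally s) term_value N p tc.1 *+ tc.2.
Proof.
rewrite -(perm_big _ (tallyK s)) big_flatten big_map; apply: eq_bigr => tc _.
by rewrite big_nseq -iter_addr_0.
Qed.

(** * Spectrum of the Laplacian *)

Lemma laplacian_sym (R : nzRingType) (n : nat) (E : {set 'I_n * 'I_n}) :
  (laplacian R E)^T = laplacian R E.
Proof.
apply/matrixP => i j; rewrite !mxE eq_sym [adj E j i]orbC.
by case: (altP (i =P j)) => [->|].
Qed.

Lemma const_laplacian (R : nzRingType) (n : nat) (E : {set 'I_n * 'I_n}) :
  const_mx 1 *m laplacian R E = 0 :> 'rV_n.
Proof.
(* Symmetry turns column sums into row sums, where the degree cancels the neighbours. *)
rewrite -laplacian_sym; apply/rowP => i.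
rewrite !mxE; under eq_bigr do rewrite !mxE mul1r.
rewrite sumrB (bigD1 i) //= eqxx mulr1n.
rewrite [X in _ + X - _]big1 ?addr0 => [|j /negbTE ji]; last by rewrite eq_sym ji.
rewrite /degree -sum1_card natr_sum big_mkcond -sumrB big1 // => j _.
by rewrite inE; case: (adj E i j); rewrite /= subrr.
Qed.

Definition laplacianC (R : rcfType) {n : nat} (E : {set 'I_n * 'I_n}) : 'M[R[i]]_n :=
  map_mx (fun x : R => x%:C) (laplacian R E).

Lemma lap_eigs_char_poly (R : rcfType) (n : nat) (E : {set 'I_n * 'I_n}) :
  char_poly (laplacianC R E) = \prod_(x <- lap_eigs R E) ('X - x%:P).
Proof.
rewrite /lap_eigs; case: closed_field_poly_normal => s /= {1}->.
by rewrite (monicP (char_poly_monic _)) scale1r.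
Qed.

Lemma size_lap_eigs (R : rcfType) (n : nat) (E : {set 'I_n * 'I_n}) :
  size (lap_eigs R E) = n.
Proof.
have := size_char_poly (laplacianC R E); rewrite lap_eigs_char_poly size_prod_XsubC.
by case.
Qed.

(** A real symmetric matrix is normal over [R[i]], so the spectral trace formula applies. *)
Lemma sum_lap_eigs_exp (R : rcfType) (n : nat) (E : {set 'I_n * 'I_n}) (k : nat) :
  \sum_(x <- lap_eigs R E) x ^+ k = (\tr (laplacian R E ^+ k))%:C.
Proof.
rewrite -(mxtrace_exp_char_poly _ _ (laplacianC R E)) ?lap_eigs_char_poly //; last first.
  apply: symmetric_normalmx.
    by apply/is_hermitianmxP; rewrite expr0 scale1r map_mx_id // /laplacianC map_trmx laplacian_sym.
  by apply/mxOverP => i j; rewrite mxE; apply/complex_realP; eexists.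
rewrite /laplacianC -trace_map_mx; congr (\tr _).
elim: k => [|k IHk]; first by rewrite !expr0 map_mx1.
by rewrite !exprS [RHS]map_mxM -IHk.
Qed.

(** The all-ones vector is an eigenvector; hence [rem 0] in [lap_eigs_nz] does remove an entry. *)
Lemma lap_eigs0 (R : rcfType) (n : nat) (E : {set 'I_n * 'I_n}) :
  (0 < n)%N -> 0 \in lap_eigs R E.
Proof.
move=> n_gt0; rewrite -root_prod_XsubC -lap_eigs_char_poly -eigenvalue_root_char.
apply/eigenvalueP; exists (const_mx 1); last first.
  apply/eqP => /rowP/(_ (Ordinal n_gt0)); rewrite !mxE => /eqP.
  by rewrite oner_eq0.
have -> : const_mx 1 = map_mx (fun x : R => x%:C) (const_mx 1) :> 'rV[R[i]]_n.
  by rewrite map_const_mx.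
by rewrite -map_mxM const_laplacian map_mx0 scale0r.
Qed.

(** The exponent is positive, so the removed zero contributes nothing. *)
Lemma sum_lap_eigs_nz_exp (R : rcfType) (n : nat) (E : {set 'I_n * 'I_n}) (k : nat) :
  (0 < n)%N ->
  \sum_(j < n.-1) (nth 0 (lap_eigs_nz R E) j) ^+ k.+1
  = (\tr (laplacian R E ^+ k.+1))%:C.
Proof.
move=> n_gt0; have e0 := lap_eigs0 R _ E n_gt0.
rewrite -sum_lap_eigs_exp (perm_big _ (perm_to_rem e0)) big_cons expr0n /= add0r.
by rewrite (big_nth 0) big_mkord size_rem // size_lap_eigs.
Qed.

(** The uniform order replaces the power of the [i]-th eigenvalue by its average over the [n - 1]
    remaining ones. *)
Lemma expect_ell_exp (R : rcfType) (n : nat) (p : R) (i k : nat) :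
  (2 <= i)%N -> (i <= n)%N ->
  expect n p (fun E s => ell R E s i ^+ k.+1)
  = ((n%:R - 1)^-1 * \sum_(t <- walk_terms k.+1 0 0 [::] 1) term_value n%:R p t)%:C.
Proof.
move=> i2 iN; have n_gt0 : (0 < n)%N by lia.
have j_lt : (i - 2 < n.-1)%N by lia.
pose j := Ordinal j_lt.
have n1E : n%:R - 1 = n.-1%:R :> R by rewrite -{1}(prednK n_gt0) -natr1 addrK.
have n1_neq0 : n.-1%:R != 0 :> R by rewrite pnatr_eq0; lia.
rewrite -expect_tr_laplacian mulr_sumr rmorph_sum /expect; apply: eq_bigr => E _.
rewrite -mulr_sumr; have := sum_perm_apply _ _ (fun a : 'I_n.-1 => nth 0 (lap_eigs_nz R E) a ^+ k.+1) j.
rewrite sum_lap_eigs_nz_exp // => sumE.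
rewrite (eq_bigr (fun s : 'S_(n.-1) => nth 0 (lap_eigs_nz R E) (s j) ^+ k.+1)); last first.
  (* Since [i - 2 < n.-1], [insub] succeeds and the default of [oapp] is not reached. *)
  by move=> s _; rewrite /ell (insubT (fun a => a < n.-1)%N j_lt).
apply: (mulfI (x := n.-1%:R)); first by rewrite pnatr_eq0; lia.
rewrite mulrCA sumE -!(rmorph_nat (real_complex R)) -!rmorphM n1E; congr (_%:C).
have f_neq0 : (n.-1)`!%:R != 0 :> R by rewrite pnatr_eq0 -lt0n fact_gt0.
by field; apply/andP.
Qed.

Theorem theorem1 (R : rcfType) (n : nat) (p : R) (hp0 : 0 < p) (hp1 : p < 1)
  (i : nat) (hi2 : (2 <= i)%N) (hin : (i <= n)%N) :
  let N : R := n%:R in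
  [/\ expect n p (fun E s => ell R E s i) = (N * p)%:C,
      expect n p (fun E s => (ell R E s i) ^+ 2)
        = (N * (N - 2) * p ^+ 2 + 2 * N * p)%:C,
      expect n p (fun E s => (ell R E s i) ^+ 3)
        = (N * (N - 2) * (N - 4) * p ^+ 3 + 6 * N * (N - 2) * p ^+ 2
           + 4 * N * p)%:C
    & expect n p (fun E s => (ell R E s i) ^+ 4)
        = (N * (N - 7) * (N - 3) * (N - 2) * p ^+ 4
           + 6 * N * (2 * N - 7) * (N - 2) * p ^+ 3
           + 25 * N * (N - 2) * p ^+ 2 + 8 * N * p)%:C].
Proof.
move=> N; have N1_neq0 : N - 1 != 0.
  by rewrite subr_eq0 pnatr_eq1; lia.
have momentE k f : \sum_(tc <- tally (walk_terms k.+1 0 0 [::] 1))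
      term_value N p tc.1 *+ tc.2 = (N - 1) * f ->
    expect n p (fun E s => ell R E s i ^+ k.+1) = f%:C.
  by move=> fE; rewrite expect_ell_exp // sum_term_value_tally fE mulKf.
(* The index is the exponent minus one; [x ^+ 1] is convertible to [x]. *)
split; [apply: (momentE 0%N)|apply: (momentE 1%N)|apply: (momentE 2%N)|apply: (momentE 3%N)].
(* The tally is a closed term without [n] or [p]; once evaluated, a polynomial identity in [N] and
   [p] remains. *)
all: set s := tally _; vm_compute in s; rewrite /s.
all: rewrite !big_cons big_nil /term_value /falling !big_ord_recr big_ord0 /=; ring.
Qed.
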